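(* Let $\mathbf{s}$ be a sequence of positive integers and let $n\ge2$. Then $$P_{n-1}^{(\mathbf{s})}(x)=\sum_{\mathbf{e}\in I_{n-1}^{(\mathbf{s})}}x^{\,s_n\,\mathrm{asc}\,\mathbf{e}-\left\lfloor\frac{s_n e_{n-1}}{s_{n-1}}\right\rfloor}.$$
   Context: For a sequence $\mathbf{s}$ of positive integers and $n\ge1$, let $\mathbf{v}_i=(0,\ldots,0,s_i,s_{i+1},\ldots,s_n)\in\mathbb{R}^n$ (first $i-1$ coordinates zero) for $1\le i\le n$, and let $\Pi_n^{(\mathbf{s})}=\left\{\sum_{i=1}^n\alpha_i\mathbf{v}_i \mid 0\le\alpha_i<1\right\}$. Define $Q_n^{(\mathbf{s})}(x)=\sum_{\lambda\in\Pi_n^{(\mathbf{s})}\cap\mathbb{Z}^n}x^{\lambda_n}$ and $$P_{n-1}^{(\mathbf{s})}(x)=\frac{Q_n^{(\mathbf{s})}(x)}{1+x+\cdots+x^{s_n-1}}.$$ The $\mathbf{s}$-inversion sequences are $I_m^{(\mathbf{s})}=\{\mathbf{e}=(e_1,\ldots,e_m)\in\mathbb{Z}^m\mid 0\le e_i<s_i \text{ for } 1\le i\le m\}$. For $\mathbf{e}\in I_m^{(\mathbf{s})}$, an index $1\le i<m$ is an ascent of $\mathbf{e}$ if $\frac{e_i}{s_i}<\frac{e_{i+1}}{s_{i+1}}$, and $0$ is an ascent if $e_1>0$; $\mathrm{asc}\,\mathbf{e}$ is the number of ascents of $\mathbf{e}$. *)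

(* Defs.v *)
From HB Require Import structures.
From mathcomp Require Import all_boot all_order all_algebra.
From mathcomp Require Import boolp classical_sets functions cardinality fsbigop.
From mathcomp Require Import reals.

Set Implicit Arguments.
Unset Strict Implicit.
Unset Printing Implicit Defensive.
Import Order.TTheory GRing.Theory Num.Theory.
Local Open Scope classical_set_scope.
Local Open Scope ring_scope.

(* Sequences s : nat -> nat and vectors are indexed from 1; s 0 is never used. *)

(* x_i for 1 <= i <= n, and the junk value 0 for i > n.  Because 0.-1 = 0,
   entry x 0 is x_1; index 0 is never used below. *)
Definition entry (n : nat) (x : 'rV[int]_n) (i : nat) : int :=
  if insub i.-1 is Some j then x ord0 j else 0.

(* (0, ..., 0, s_i, ..., s_n); the column j : 'I_n is the coordinate j.+1. *)
Definition gen (R : realType) (s : nat -> nat) (n i : nat) : 'rV[R]_n :=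
  \row_(j < n) (if (i <= j.+1)%N then (s j.+1)%:R else 0).

Definition parallelepiped (R : realType) (s : nat -> nat) (n : nat) :
    set 'rV[R]_n :=
  [set x | exists a : nat -> R,
     (forall i : nat, (1 <= i <= n)%N -> 0 <= a i < 1) /\
     x = \sum_(1 <= i < n.+1) a i *: gen R s n i].
Arguments parallelepiped : clear implicits.

Definition lattice_points (R : realType) (s : nat -> nat) (n : nat) :
    set 'rV[int]_n :=
  [set l | parallelepiped R s n (map_mx (intr : int -> R) l)].
Arguments lattice_points : clear implicits.

(* Generating functions live in the field of rational functions, where the
   quotient defining P and integer exponents are the genuine ones.
   A sum over \in would be 0 if its support were infinite; the sets summed over
   here are bounded sets of integer vectors, hence finite. *)
Notation ratfun := {fraction {poly int}}.

Definition X : ratfun := FracField.tofrac ('X : {poly int}).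

Definition Q (R : realType) (s : nat -> nat) (n : nat) : ratfun :=
  \sum_(l \in lattice_points R s n) X ^ (entry l n).

(* P R s m is P_m, that is, Q_(m+1) / (1 + x + ... + x^(s_(m+1) - 1)). *)
Definition P (R : realType) (s : nat -> nat) (m : nat) : ratfun :=
  Q R s m.+1 / \sum_(0 <= k < s m.+1) X ^+ k.

Definition inversion_seqs (s : nat -> nat) (m : nat) : set 'rV[int]_m :=
  [set e | forall i : nat, (1 <= i <= m)%N -> 0 <= entry e i < (s i)%:Z].
Arguments inversion_seqs : clear implicits.

Definition is_ascent (s : nat -> nat) (m : nat) (e : 'rV[int]_m) (i : nat) :
    bool :=
  if i is 0 then 0 < entry e 1
  else (entry e i)%:~R / (s i)%:R < (entry e i.+1)%:~R / (s i.+1)%:R :> rat.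

Definition asc (s : nat -> nat) (m : nat) (e : 'rV[int]_m) : nat :=
  #|[pred i : 'I_m | is_ascent s e i]|.

(* Main.v *)
(* Put l_0 / s_0 = 0.  An integer vector l lies in the parallelepiped iff
   0 <= l_i / s_i - l_(i-1) / s_(i-1) < 1 for 1 <= i <= n.  Writing
   l_i = s_i q_i - e_i with 0 <= e_i < s_i, this inequality forces q_i - q_(i-1)
   to be the indicator that i - 1 is an ascent of e, so l_1, ..., l_(n-1)
   correspond bijectively to e in I_(n-1), with
   l_(n-1) / s_(n-1) = asc e - e_(n-1) / s_(n-1).  Given e, the last coordinate
   ranges over s_n consecutive integers starting at
   s_n asc e - floor (s_n e_(n-1) / s_(n-1)), which yields the factor
   1 + x + ... + x^(s_n - 1). *)
Require Import Defs.
From mathcomp Require Import all_boot all_order all_algebra.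
From mathcomp Require Import boolp classical_sets functions cardinality fsbigop.
From mathcomp Require Import reals.
From mathcomp Require Import ring lra zify.
Import Order.TTheory GRing.Theory Num.Theory.
Local Open Scope ring_scope.

Lemma entryE {n} (x : 'rV[int]_n) (j : 'I_n) : entry x j.+1 = x ord0 j.
Proof. by rewrite /entry /= valK. Qed.

Lemma eq_entry {n} (x y : 'rV[int]_n) :
  (forall i, (1 <= i <= n)%N -> entry x i = entry y i) -> x = y.
Proof.
move=> xy; apply/rowP => j; have := xy j.+1.
by rewrite !entryE => ->//=.
Qed.

Lemma entry_row n (f : nat -> int) i : (1 <= i <= n)%N ->
  entry (\row_(j < n) f j.+1) i = f i.
Proof. by case: i => // i lt_in; rewrite (entryE _ (Ordinal lt_in)) mxE. Qed.

(* The value 0 at index 0 makes ascents at 0 and the constraint on l_1 instances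
   of the general case. *)
Definition slope (s : nat -> nat) {n} (x : 'rV[int]_n) (i : nat) : rat :=
  if i is 0 then 0 else (entry x i)%:~R / (s i)%:R.
Arguments slope : simpl never.

Lemma is_ascentE s {n} (e : 'rV[int]_n) i : (0 < s 1)%N ->
  is_ascent s e i = (slope s e i < slope s e i.+1).
Proof. by case: i => //= s1; rewrite /slope pmulr_lgt0 ?invr_gt0 ?ltr0n // ltr0z. Qed.

(** Column [j] meets only the generators of index at most [j.+1], and each of them has the same
    entry [s j.+1] there. *)
Lemma parallelepiped_comb (R : realType) s n (a : nat -> R) (j : 'I_n) :
  (\sum_(1 <= i < n.+1) a i *: gen R s n i) ord0 j =
  (s j.+1)%:R * \sum_(1 <= i < j.+2) a i.
Proof.
rewrite summxE (@big_cat_nat _ _ _ j.+2) //=; last by rewrite !ltnS.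
rewrite [X in _ + X]big_nat_cond [X in _ + X]big1 ?addr0; last first.
  by move=> i /andP[/andP[ji _] _]; rewrite !mxE leqNgt ji mulr0.
rewrite mulr_sumr; apply: eq_big_nat => i /andP[_ ij].
by rewrite !mxE -ltnS ij mulrC.
Qed.

(** The slopes of [l] are the partial sums of its coefficients, so the coefficients are forced to be
    successive differences of slopes. These are rational, so membership does not depend on [R]. *)
Lemma lattice_pointsP (R : realType) s n (l : 'rV[int]_n) :
  (forall i, (1 <= i)%N -> (0 < s i)%N) ->
  lattice_points R s n l <->
  forall k, (k < n)%N -> 0 <= slope s l k.+1 - slope s l k < 1.
Proof.
move=> s_gt0; split=> [[a [a01 la]] k kn | sl].
  have slE i : (i <= n)%N -> ratr (slope s l i) = \sum_(1 <= i < i.+1) a i.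
    case: i => [|i] i_n; first by rewrite /slope rmorph0 big_geq.
    have /rowP/(_ (Ordinal i_n)) := la.
    rewrite mxE parallelepiped_comb /= /slope (entryE _ (Ordinal i_n)).
    rewrite fmorph_div rmorph_int rmorph_nat => ->.
    by rewrite mulrC mulKf // pnatr_eq0 -lt0n s_gt0.
  have : 0 <= a k.+1 < 1 by apply: a01.
  suff -> : a k.+1 = ratr (slope s l k.+1 - slope s l k).
    by rewrite -(rmorph0 (@ratr R)) -[X in _ < X](rmorph1 (@ratr R)) ler_rat ltr_rat.
  by rewrite rmorphB /= !slE ?(ltnW kn) // big_nat_recr //= addrAC subrr add0r.
exists (fun i => ratr (slope s l i - slope s l i.-1)); split=> [[|i] //= lt_in|].
  by rewrite -(rmorph0 (@ratr R)) -[X in _ < X](rmorph1 (@ratr R)) ler_rat ltr_rat sl.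
apply/rowP=> j; rewrite parallelepiped_comb mxE big_add1 /= -rmorph_sum.
rewrite telescope_sumr //= subr0 /slope entryE fmorph_div rmorph_int rmorph_nat.
by rewrite mulrC divfK // pnatr_eq0 -lt0n s_gt0.
Qed.

(** Since [a - b] lies strictly between -1 and 1, exactly one integer shift brings it into [0,
    1). *)
Lemma ascent_incr (a b : rat) (d : int) : 0 <= a < 1 -> 0 <= b < 1 ->
  (0 <= d%:~R - b + a < 1) = (d == (a < b)%R).
Proof.
move=> a01 b01; apply/idP/eqP => [dP|->]; last by case: ltP => /= ab; lra.
have d1 : -1 < d by rewrite -(ltr_int rat) rmorphN1; lra.
have d2 : d < 2 by rewrite -(ltr_int rat); lra.
have : d = 0 \/ d = 1 by lia.
by case=> dE; rewrite dE in dP *; case: ltP => ab; rewrite ?mulr0z ?mulr1z in dP *; first [by [] | exfalso; lra].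
Qed.

Lemma last_coordinate (q : nat) (x c : int) (t : rat) : (0 < q)%N ->
  (0 <= x%:~R / q%:R - (c%:~R - t) < 1) =
  (0 <= x - (q%:Z * c - Num.floor (q%:R * t)) < q%:Z).
Proof.
move=> q_gt0; have qR : 0 < (q%:R : rat) by rewrite ltr0n.
set f := Num.floor _; have /andP[f1 f2] := floor_itv (q%:R * t).
rewrite -/f in f1 f2.
rewrite subr_ge0 ltrBlDr ler_pdivlMr // ltr_pdivrMr //.
have -> : (c%:~R - t) * q%:R = (q%:Z * c)%:~R - q%:R * t.
  by rewrite intrM; ring.
have -> : (1 + (c%:~R - t)) * q%:R = (q%:Z + q%:Z * c)%:~R - q%:R * t.
  by rewrite intrD intrM; ring.
(* Each bound now compares an integer with [q%:R * t]; as [f <= q%:R * t < f + 1], this amounts to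
   comparing it with [f]. *)
congr (_ && _); apply/idP/idP => h.
- suff : q%:Z * c < x + (f + 1) by lia.
  rewrite -(ltr_int rat) [(x + _)%:~R]intrD; lra.
- have : (q%:Z * c)%:~R <= (x + f)%:~R :> rat by rewrite ler_int; lia.
  rewrite intrD; lra.
- suff : x + f < q%:Z + q%:Z * c by lia.
  rewrite -(ltr_int rat) [(x + f)%:~R]intrD; lra.
- have : (x + (f + 1))%:~R <= (q%:Z + q%:Z * c)%:~R :> rat by rewrite ler_int; lia.
  rewrite intrD; lra.
Qed.

(** This is the quotient [q_i] in [l_i = s_i q_i - e_i]. *)
Definition nasc (s : nat -> nat) {m} (e : 'rV[int]_m) (i : nat) : nat :=
  \sum_(k < i) is_ascent s e k.

Lemma nascE s {m} (e : 'rV[int]_m) : nasc s e m = asc s e.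
Proof.
rewrite /nasc /asc -sum1_card [RHS]big_mkcond /=.
by apply: eq_bigr => i _; rewrite inE; case: is_ascent.
Qed.

Lemma slope_inversion_seqs s {m} (e : 'rV[int]_m) i :
  inversion_seqs s m e -> (i <= m)%N -> 0 <= slope s e i < 1.
Proof.
case: i => [|i] // eI im; have /andP[e0 es] := eI i.+1 im.
have s0 : 0 < ((s i.+1)%:R : rat) by rewrite ltr0n; lia.
rewrite /slope divr_ge0 ?ler0z ?ler0n //=.
by rewrite ltr_pdivrMr // mul1r -[ltRHS]/((s i.+1)%:Z%:~R) ltr_int.
Qed.

(* The least last coordinate of a lattice point lying over e. *)
Definition offset (s : nat -> nat) {m} (e : 'rV[int]_m) : int :=
  (s m.+1 * asc s e)%N%:Z
  - Num.floor ((s m.+1)%:R * (entry e m)%:~R / (s m)%:R : rat).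

Definition lift_inversion (s : nat -> nat) {m} (ek : 'rV[int]_m * nat) : 'rV[int]_m.+1 :=
  \row_(j < m.+1) (if (j.+1 <= m)%N
                   then (s j.+1 * nasc s ek.1 j.+1)%N%:Z - entry ek.1 j.+1
                   else offset s ek.1 + ek.2%:Z).

Lemma entry_lift_inversion s {m} (e : 'rV[int]_m) k i : (1 <= i <= m)%N ->
  entry (lift_inversion s (e, k)) i = (s i * nasc s e i)%N%:Z - entry e i.
Proof.
move=> /andP[i1 im]; pose f i : int := if (i <= m)%N then
  (s i * nasc s e i)%N%:Z - entry e i else offset s e + k%:Z.
by rewrite (entry_row _ f) ?i1 ?leqW // /f im.
Qed.

Lemma entry_lift_inversion_last s {m} (e : 'rV[int]_m) k :
  entry (lift_inversion s (e, k)) m.+1 = offset s e + k%:Z.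
Proof. by rewrite (entryE _ ord_max) mxE /= ltnn. Qed.

Section Bijection.
Variables (s : nat -> nat) (m : nat).
Hypothesis s_gt0 : forall i, (1 <= i)%N -> (0 < s i)%N.
Hypothesis m_gt0 : (0 < m)%N.

Let sR i : (1 <= i)%N -> (s i)%:R != 0 :> rat.
Proof. by move=> i1; rewrite pnatr_eq0 -lt0n s_gt0. Qed.

Lemma slope_quotient (e : 'rV[int]_m) (l : 'rV[int]_m.+1) (q : int) i :
  (1 <= i)%N ->
  (slope s l i == q%:~R - slope s e i) = (entry l i == (s i)%:Z * q - entry e i).
Proof.
case: i => // i _; rewrite /slope -(eqr_int rat) intrB intrM.
rewrite -(inj_eq (mulIf (sR i.+1 isT))) mulrBl !divfK ?sR //.
by rewrite [q%:~R * _]mulrC.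
Qed.

(** Serves both directions of the bijection: with [d] the ascent count it puts the lift in the
    parallelepiped, and for a given lattice point it forces the next quotient. *)
Lemma slope_succ (e : 'rV[int]_m) (l : 'rV[int]_m.+1) (i : nat) (d : int) :
  inversion_seqs s m e -> (i < m)%N ->
  slope s l i = (nasc s e i)%:~R - slope s e i ->
  slope s l i.+1 = d%:~R - slope s e i.+1 ->
  (0 <= slope s l i.+1 - slope s l i < 1) = (d == nasc s e i.+1).
Proof.
move=> eI im -> ->.
have -> : (d%:~R - slope s e i.+1 - ((nasc s e i)%:~R - slope s e i)) =
    ((d - (nasc s e i)%:Z)%:~R - slope s e i.+1 + slope s e i).
  by rewrite intrB; ring.
rewrite ascent_incr ?slope_inversion_seqs ?(ltnW im) //.
by rewrite /nasc big_ord_recr /= is_ascentE ?s_gt0 // subr_eq PoszD addrC.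
Qed.

Lemma slope_last (e : 'rV[int]_m) (l : 'rV[int]_m.+1) :
  slope s l m = (nasc s e m)%:~R - slope s e m ->
  (0 <= slope s l m.+1 - slope s l m < 1) =
  (0 <= entry l m.+1 - offset s e < (s m.+1)%:Z).
Proof.
move=> ->; rewrite [slope s l m.+1]/slope last_coordinate ?s_gt0 //.
rewrite /offset nascE PoszM -mulrA.
suff -> : slope s e m = (entry e m)%:~R / (s m)%:R by [].
(* [slope] unfolds to this quotient only at a positive index. *)
by case: m m_gt0 e l.
Qed.

Lemma slope_lift_inversion (e : 'rV[int]_m) k i : (i <= m)%N ->
  slope s (lift_inversion s (e, k)) i = (nasc s e i)%:~R - slope s e i.
Proof.
case: i => [|i] im; first by rewrite /nasc big_ord0 subr0.
by apply/eqP; rewrite slope_quotient // entry_lift_inversion // PoszM.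
Qed.

Lemma lift_inversion_bij (R : realType) :
  set_bij (inversion_seqs s m `*` `I_(s m.+1))%classic
          (lattice_points R s m.+1) (lift_inversion s).
Proof.
split.
- move=> [e k] [/= eI ks]; apply/(lattice_pointsP R _ _ _ s_gt0) => i.
  rewrite ltnS leq_eqVlt => /orP[/eqP->|im].
    rewrite (slope_last e) ?slope_lift_inversion // entry_lift_inversion_last addrAC subrr add0r.
    by rewrite ltz_nat.
  by rewrite (slope_succ e _ _ (nasc s e i.+1)) ?slope_lift_inversion ?(ltnW im).
- move=> [e k] [e' k']; rewrite !inE => -[/= eI _] [/= eI' _] ee'.
  (* Injectivity: [e_i] is recovered from the lift as the remainder of [- l_i] modulo [s_i]. *)
  have remE (x : 'rV[int]_m) h i : inversion_seqs s m x -> (1 <= i <= m)%N ->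
      entry x i = (- entry (lift_inversion s (x, h)) i %% s i)%Z.
    move=> xI im; rewrite entry_lift_inversion // opprB addrC PoszM mulrC -mulNr.
    by rewrite modzMDl modz_small //; exact: xI.
  have eqe : e = e'.
    by apply: eq_entry => i im; rewrite (remE e k) // ee' -remE.
  congr (_, _) => //; have := congr1 (fun l => entry l m.+1) ee'.
  by rewrite /= !entry_lift_inversion_last eqe => /addrI[].
- move=> l /(lattice_pointsP R _ _ _ s_gt0) lP.
  (* Surjectivity: dividing [- l_i] by [s_i] gives remainder [e_i] and quotient [- q_i]; induction
     on [i] then identifies [q_i] with the ascent count. *)
  pose e : 'rV[int]_m := \row_(j < m) (- entry l j.+1 %% s j.+1)%Z.
  have eE i : (1 <= i <= m)%N -> entry e i = (- entry l i %% s i)%Z.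
    exact: (entry_row _ (fun i => (- entry l i %% s i)%Z)).
  have eI : inversion_seqs s m e.
    move=> i im; rewrite eE //; have /s_gt0 si : (1 <= i)%N by lia.
    by rewrite modz_ge0 ?ltz_pmod //; lia.
  have lE i : (i <= m)%N -> slope s l i = (nasc s e i)%:~R - slope s e i.
    elim: i => [|i IHi] im; first by rewrite /nasc big_ord0 subr0.
    have sE : slope s l i.+1 =
        (- (- entry l i.+1 %/ s i.+1)%Z)%:~R - slope s e i.+1.
      apply/eqP; rewrite slope_quotient // eE //.
      by have := divz_eq (- entry l i.+1) (s i.+1); lia.
    have := lP i (ltnW im).
    by rewrite (slope_succ e l i _ eI im (IHi (ltnW im)) sE) sE => /eqP->.
  have /andP[k0 ks] : 0 <= entry l m.+1 - offset s e < (s m.+1)%:Z.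
    by rewrite -(slope_last _ _ (lE m (leqnn m))) lP.
  exists (e, `|entry l m.+1 - offset s e|%N); first by split => //=; lia.
  apply: eq_entry => i /andP[i1]; rewrite leq_eqVlt => /orP[/eqP->|].
    by rewrite entry_lift_inversion_last; lia.
  rewrite ltnS => im; rewrite entry_lift_inversion ?i1 //.
  by apply/esym/eqP; rewrite PoszM -slope_quotient // lE.
Qed.

End Bijection.

(** Finiteness lets the double sum be merged into one sum over pairs. Bounding all entries by one
    [M] makes the set part of the image of a finite function type. *)
Lemma finite_inversion_seqs s m : finite_set (inversion_seqs s m).
Proof.
pose M := (\max_(i < m.+1) s i)%N.
pose f (g : {ffun 'I_m -> 'I_M}) : 'rV[int]_m := \row_j (g j)%:Z.
apply: (sub_finite_set _ (finite_image f (@finite_finset _ setT))) => e eI.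
have eP (j : 'I_m) : (`|e ord0 j| < M)%N.
  have := eI j.+1 (ltn_ord j); rewrite entryE => /andP[e0 es].
  have jm : (j.+1 < m.+1)%N by rewrite ltnS.
  have := leq_bigmax (Ordinal jm) (F := fun i : 'I_m.+1 => s i).
  by rewrite -/M /=; lia.
exists [ffun j => Ordinal (eP j)] => //; apply/rowP => j.
have := eI j.+1 (ltn_ord j); rewrite entryE => /andP[e0 _].
by rewrite mxE ffunE /= gez0_abs.
Qed.

Lemma X_neq0 : X != 0.
Proof. by rewrite tofrac_eq0 polyX_eq0. Qed.

(** The underlying polynomial takes the value [q] at 1. *)
Lemma sum_X_neq0 (q : nat) : (0 < q)%N -> \sum_(0 <= k < q) X ^+ k != 0.
Proof.
move=> q0; under eq_bigr do rewrite -rmorphXn; rewrite -rmorph_sum /=.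
rewrite tofrac_eq0; apply/eqP => /(congr1 (horner^~ 1)).
rewrite horner_sum horner0; under eq_bigr do rewrite hornerXn expr1n.
by rewrite sumr_const_nat subn0; lia.
Qed.

Theorem theorem4p1 (R : realType) (s : nat -> nat)
    (s_gt0 : forall i : nat, (1 <= i)%N -> (0 < s i)%N)
    (n : nat) (n_ge2 : (2 <= n)%N) :
  P R s n.-1 =
  \sum_(e \in inversion_seqs s n.-1)
     X ^ ((s n * asc s e)%N%:Z
          - Num.floor ((s n)%:R * (entry e n.-1)%:~R / (s n.-1)%:R : rat)).
Proof.
case: n n_ge2 => [|m] //; rewrite ltnS => m_gt0 /=.
rewrite /P; apply: (mulIf (sum_X_neq0 _ (s_gt0 m.+1 isT))).
rewrite divfK ?sum_X_neq0 ?s_gt0 //.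
(* With the denominator cleared, both sides become sums over pairs [(e, k)], the factor [X ^+ k]
   coming from the geometric sum. *)
rewrite /Q (reindex_fsbig _ _ _ _ (lift_inversion_bij _ _ s_gt0 m_gt0 R)).
rewrite mulr_fsuml big_mkord.
under [RHS]eq_fsbigr do rewrite mulr_sumr (fsbig_ord _ (s m.+1) (fun k => _ * X ^+ k)).
rewrite (pair_fsbig _ _ (finite_inversion_seqs _ _) (finite_II _)).
apply: eq_fsbigr => -[e k] _.
by rewrite entry_lift_inversion_last expfzDr ?X_neq0.
Qed.
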